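(* Let $M\ge 1$ and let $\{\mathcal{T}^{(m)}\}_{m=1}^M$, $\mathcal{T}^{(m)}=\langle \mathcal{S},\mathcal{A},p,r^{(m)},\gamma,\beta,\pi_0\rangle$, be entropy-regularized tasks differing only in their reward functions, with optimal action-value functions $Q^{(m)}$. Let $f\colon\mathbb{R}^M\to\mathbb{R}$ be a bounded function, and let $\widetilde{Q}^*,\widetilde{V}^*,\widetilde{\pi}^*$ be the optimal action-value function, optimal state-value function and optimal policy of the composition of $\{\mathcal{T}^{(m)}\}$ under $f$, i.e. of the task $\langle \mathcal{S},\mathcal{A},p,\widetilde r,\gamma,\beta,\pi_0\rangle$ with reward $\widetilde r(s,a,s') = f(\{r^{(m)}(s,a,s')\}_{m=1}^M)$. Define $$V_f(s) = \frac{1}{\beta}\log\mathbb{E}_{a\sim\pi_0(\cdot\mid s)}\exp\left(\beta f(\{Q^{(m)}(s,a)\})\right),\qquad \pi_f(a\mid s) = \frac{\pi_0(a\mid s)e^{\beta f(\{Q^{(m)}(s,a)\})}}{e^{\beta V_f(s)}},$$ $$\kappa(s,a,s') = \left[f(\{r^{(m)}(s,a,s')\}) + \gamma V_f(s')\right] - f(\{Q^{(m)}(s,a)\}).$$ Let $K^*$ be the solution of the Bellman optimality equation $$K^*(s,a) = \mathbb{E}_{s'\sim p(\cdot\mid s,a)}\left[\kappa(s,a,s') + \frac{\gamma}{\beta}\log\mathbb{E}_{a'\sim\pi_f(\cdot\mid s')} e^{\beta K^*(s',a')}\right],$$ with corresponding state-value function $V_K^*(s)=\frac1\beta\log\sum_a\pi_f(a\mid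 s)e^{\beta K^*(s,a)}$ and optimal policy $\pi_K^*(a\mid s)=\pi_f(a\mid s)e^{\beta K^*(s,a)}/e^{\beta V_K^*(s)}$. Then for all $s\in\mathcal{S}$, $a\in\mathcal{A}$: $$\widetilde{Q}^*(s,a) = f(\{Q^{(m)}(s,a)\}) + K^*(s,a),\qquad \widetilde{V}^*(s) = V_f(s)+V_K^*(s),\qquad \widetilde{\pi}^*(a\mid s)=\pi_K^*(a\mid s).$$
   Context: An entropy-regularized task $\langle \mathcal{S},\mathcal{A},p,r,\gamma,\beta,\pi_0\rangle$ consists of discrete (finite or countable) state and action sets $\mathcal{S},\mathcal{A}$, transition dynamics $p(s'\mid s,a)$ (a probability distribution over $s'$ for each $(s,a)$), a bounded reward function $r\colon \mathcal{S}\times\mathcal{A}\times\mathcal{S}\to\mathbb{R}$, a discount factor $\gamma\in(0,1)$, an inverse temperature $\beta>0$, and a prior policy $\pi_0\colon\mathcal{S}\times\mathcal{A}\to(0,1)$ (for each $s$, $\pi_0(\cdot\mid s)$ is a probability distribution on $\mathcal{A}$). The optimal action-value function $Q^*$ of the task is the (unique) bounded solution of the soft Bellman optimality equation $$Q^*(s,a) = \mathbb{E}_{s'\sim p(\cdot\mid s,a)}\left[r(s,a,s') + \frac{\gamma}{\beta}\log \mathbb{E}_{a'\sim\pi_0(\cdot\mid s')} e^{\beta Q^*(s',a')}\right].$$ The optimal state-value function is $V^*(s)=\frac{1}{\beta}\log\sum_a\pi_0(a\mid s)e^{\beta Q^*(s,a)}$, and the optimal policy is $\pi^*(a\mid s)=\pi_0(a\mid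 s)e^{\beta Q^*(s,a)}/\sum_{a'}\pi_0(a'\mid s)e^{\beta Q^*(s,a')}$. Thus $K^*,V_K^*,\pi_K^*$ are the optimal quantities of the task with reward $\kappa$ and prior policy $\pi_f$ (same $p,\gamma,\beta$); $K^*$ denotes the bounded solution of its equation. The notation $f(\{x^{(m)}\})$ means $f(x^{(1)},\dots,x^{(M)})$. *)

(* Defs.v *)
From HB Require Import structures.
From mathcomp Require Import all_boot all_order all_algebra.
From mathcomp Require Import all_classical all_reals all_analysis.
Import Order.TTheory GRing.Theory Num.Theory.
Import numFieldNormedType.Exports.

Set Implicit Arguments.
Unset Strict Implicit.
Unset Printing Implicit Defensive.

Local Open Scope classical_set_scope.
Local Open Scope ring_scope.

(* [esum] is meant for nonnegative families, so a signed sum is the difference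
   of the sums of the positive and negative parts. It is the usual sum when the
   family is absolutely summable; otherwise the value is junk. *)
Definition csum (R : realType) (T : countType) (h : T -> R) : R :=
  fine (\esum_(x in [set: T]) ((EFin \o h)^\+ x)%E)
  - fine (\esum_(x in [set: T]) ((EFin \o h)^\- x)%E).

Definition is_pmf (R : realType) (T : countType) (q : T -> R) : Prop :=
  (forall x, 0 <= q x) /\ (\esum_(x in [set: T]) (q x)%:E = 1)%E.

Definition expect (R : realType) (T : countType) (q h : T -> R) : R :=
  csum (fun x => q x * h x).

(* [countType] covers both finite and countably infinite sets. Conditional
   distributions take the conditioning first: [trans t s a s'] is p(s' | s, a)
   and [prior t s a] is pi_0(a | s). *)
Record task (R : realType) (S A : countType) := Task {
  trans : S -> A -> S -> R;
  reward : S -> A -> S -> R;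
  discount : R;
  invtemp : R;
  prior : S -> A -> R }.

Record is_er_task (R : realType) (S A : countType) (t : task R S A) : Prop :=
  IsERTask {
    trans_pmf : forall s a, is_pmf (trans t s a);
    reward_bounded :
      [bounded reward t x.1.1 x.1.2 x.2 | x in [set: S * A * S]];
    discount_itv : 0 < discount t < 1;
    invtemp_gt0 : 0 < invtemp t;
    prior_pmf : forall s, is_pmf (prior t s);
    prior_itv : forall s a, 0 < prior t s a < 1 }.

Definition soft_bellman (R : realType) (S A : countType) (t : task R S A)
    (Q : S -> A -> R) : Prop :=
  forall s a, Q s a =
    expect (trans t s a) (fun s' => reward t s a s' +
      discount t / invtemp t *
      ln (expect (prior t s') (fun a' => expR (invtemp t * Q s' a')))).

Definition is_optimal_Q (R : realType) (S A : countType) (t : task R S A)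
    (Q : S -> A -> R) : Prop :=
  [bounded Q x.1 x.2 | x in [set: S * A]] /\ soft_bellman t Q.

Definition soft_value (R : realType) (S A : countType) (beta : R)
    (pi : S -> A -> R) (Q : S -> A -> R) (s : S) : R :=
  beta^-1 * ln (expect (pi s) (fun a => expR (beta * Q s a))).

Definition soft_policy (R : realType) (S A : countType) (beta : R)
    (pi : S -> A -> R) (Q : S -> A -> R) (s : S) (a : A) : R :=
  pi s a * expR (beta * Q s a) / expR (beta * soft_value beta pi Q s).

Definition opt_value (R : realType) (S A : countType) (t : task R S A)
    (Q : S -> A -> R) (s : S) : R :=
  soft_value (invtemp t) (prior t) Q s.

Definition opt_policy (R : realType) (S A : countType) (t : task R S A)
    (Q : S -> A -> R) (s : S) (a : A) : R :=
  prior t s a * expR (invtemp t * Q s a)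
  / csum (fun a' => prior t s a' * expR (invtemp t * Q s a')).

Definition comp_reward (R : realType) (S A : countType) (M : nat)
    (f : 'rV[R]_M -> R) (r : 'I_M -> S -> A -> S -> R)
    (s : S) (a : A) (s' : S) : R :=
  f (\row_m r m s a s').

Definition comp_Q (R : realType) (S A : countType) (M : nat)
    (f : 'rV[R]_M -> R) (Q : 'I_M -> S -> A -> R) (s : S) (a : A) : R :=
  f (\row_m Q m s a).

Definition kappa (R : realType) (S A : countType) (M : nat)
    (f : 'rV[R]_M -> R) (gamma beta : R) (pi0 : S -> A -> R)
    (r : 'I_M -> S -> A -> S -> R) (Q : 'I_M -> S -> A -> R)
    (s : S) (a : A) (s' : S) : R :=
  (comp_reward f r s a s' + gamma * soft_value beta pi0 (comp_Q f Q) s')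
  - comp_Q f Q s a.

(* Main.v *)
(* Write F = f({Q^(m)}), bounded because f is. Reweighting the prior by
   e^(beta F) turns the log-partition function of K under pi_f into that of
   F + K under pi_0 minus V_f, and the terms gamma V_f and F in kappa cancel
   accordingly: F + K solves the Bellman equation of the composed task. The
   soft Bellman operator is a sup-norm contraction of factor gamma, so bounded
   solutions are unique and Qt = F + K. *)
Require Import Defs.
From HB Require Import structures.
From mathcomp Require Import all_boot all_order all_algebra.
From mathcomp Require Import all_classical all_reals all_analysis.
From mathcomp Require Import ring.
Import Order.TTheory GRing.Theory Num.Theory.
Import numFieldNormedType.Exports.

Local Open Scope classical_set_scope.
Local Open Scope ring_scope.

Set Implicit Arguments.
Unset Strict Implicit.
Unset Printing Implicit Defensive.
Unset SsrOldRewriteGoalsOrder.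

(** * Signed countable sums and expectations *)

Lemma esumZl (R : realType) (T : choiceType) (D : set T) (c : R)
    (a : T -> \bar R) : 0 <= c -> (forall x, 0 <= a x)%E ->
  (\esum_(x in D) (c%:E * a x) = c%:E * \esum_(x in D) a x)%E.
Proof.
move=> c0 a0; rewrite /esum -ereal_supZl//.
  (* The supremum scales because the set of finite partial sums is nonempty: it contains the empty
     sum. *)
  by apply/set0P; exists (\sum_(x \in set0) a x)%E, set0 => //; exact: fsets_set0.
congr ereal_sup; apply/seteqP; split => [_ [X fX <-]|_ [_ [X fX <-] <-]] /=.
  by exists (\sum_(x \in X) a x)%E; [exists X|rewrite ge0_mule_fsumr].
by exists X; rewrite // ge0_mule_fsumr.
Qed.

Section csum.
Variables (R : realType) (T : countType).
Implicit Types a b q h : T -> R.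

Local Notation summable a := (summable [set: T] (EFin \o a)).

Lemma summable_realZ c a : summable a -> summable (c \*o a).
Proof.
rewrite /esum.summable => sa.
under eq_esum do rewrite /= normrM EFinM.
by rewrite esumZl// lte_mul_pinfty// lee_fin.
Qed.

Lemma csum_ge0E a : (forall x, 0 <= a x) ->
  csum a = fine (\esum_(x in [set: T]) (a x)%:E).
Proof.
move=> a0; rewrite /csum [X in _ - fine X]esum1 ?subr0.
  by move=> x _; rewrite (@ge0_funenegE _ _ setT) ?inE// => y _ /=; rewrite lee_fin.
congr fine; apply: eq_esum => x _.
by rewrite (@ge0_funeposE _ _ setT) ?inE// => y _ /=; rewrite lee_fin.
Qed.

Lemma csum_ge0 a : (forall x, 0 <= a x) -> 0 <= csum a.
Proof.
by move=> a0; rewrite csum_ge0E// fine_ge0// esum_ge0// => x _; rewrite lee_fin.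
Qed.

Lemma esum_fin_num a : (forall x, 0 <= a x) -> summable a ->
  (\esum_(x in [set: T]) (a x)%:E)%E \is a fin_num.
Proof.
move=> a0; rewrite summableE; congr (_ \is a fin_num).
by apply: eq_esum => x _ /=; rewrite ger0_norm.
Qed.

Lemma csum_ge0D a b : (forall x, 0 <= a x) -> (forall x, 0 <= b x) ->
  summable a -> summable b -> csum (a \+ b) = csum a + csum b.
Proof.
move=> a0 b0 sa sb; rewrite !csum_ge0E//; first by move=> x; rewrite addr_ge0.
by rewrite -fineD ?esum_fin_num// -esumD// => x _; rewrite lee_fin.
Qed.

(** The positive and negative parts of [a \- b] need not be [a] and [b]; [esumB] says that both
    splittings give the same difference of sums. *)
Lemma csum_ge0B a b : (forall x, 0 <= a x) -> (forall x, 0 <= b x) ->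
  summable a -> summable b -> csum (a \- b) = csum a - csum b.
Proof.
move=> a0 b0 sa sb; have sab := summableB sa sb.
rewrite (csum_ge0E a0) (csum_ge0E b0) -fineB ?esum_fin_num// -esumB//.
- by move=> x _; rewrite lee_fin.
- by move=> x _; rewrite lee_fin.
rewrite /csum fineB// ge0_fin_numE ?esum_ge0//.
- by have := summable_funepos sab; rewrite /esum.summable;
    under eq_esum do rewrite gee0_abs//.
- by have := summable_funeneg sab; rewrite /esum.summable;
    under eq_esum do rewrite gee0_abs//.
Qed.

Lemma summable_norm a : summable a -> summable (Num.norm \o a).
Proof.
by rewrite /esum.summable; under [X in _ -> (X < _)%E]eq_esum do rewrite /= normr_id.
Qed.

Lemma csumN a : csum (\- a) = - csum a.
Proof.
rewrite /csum opprB (_ : EFin \o (\- a)%R = \- (EFin \o a))%E//.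
by rewrite funeposN funenegN.
Qed.

Lemma csumD a b : summable a -> summable b -> csum (a \+ b) = csum a + csum b.
Proof.
(* Shifting by absolute values reduces to sums of nonnegative families. *)
move=> sa sb; have [na nb] := (summable_norm sa, summable_norm sb).
have norm_ge0 h x : 0 <= (Num.norm \o h) x by exact: normr_ge0.
have shift_ge0 h x : 0 <= (Num.norm \o h \+ h) x.
  by have := ler_norm (- h x); rewrite normrN -subr_ge0 opprK.

have shift h : h = (Num.norm \o h \+ h) \- (Num.norm \o h).
  by apply/funext => x /=; rewrite addrAC subrr add0r.
have csum_shift h : summable h ->
    csum h = csum (Num.norm \o h \+ h) - csum (Num.norm \o h).
  move=> sh; rewrite {1}(shift h) csum_ge0B//; last exact: summable_norm.
  exact: summableD (summable_norm sh) sh.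
rewrite (csum_shift a)// (csum_shift b)// addrACA -opprD -!csum_ge0D//.
- by apply: (summableD na sa).
- by apply: (summableD nb sb).
rewrite -csum_ge0B//.
- by move=> x; exact: addr_ge0.
- by move=> x; exact: addr_ge0.
- exact: summableD (summableD na sa) (summableD nb sb).
- exact: summableD na nb.
- by congr csum; apply/funext => x /=; ring.
Qed.

Lemma csumB a b : summable a -> summable b -> csum (a \- b) = csum a - csum b.
Proof.
move=> sa sb; rewrite -csumN -csumD//.
by have := sb; rewrite summableN.
Qed.

(** Scaling by [c >= 0] commutes with taking positive and negative parts, and summability makes both
    sums finite. *)
Lemma csumZ c a : 0 <= c -> summable a -> csum (c \*o a) = c * csum a.
Proof.
move=> c0 sa; rewrite /csum (_ : EFin \o _ = fun x => c%:E * (EFin \o a) x)%E//.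
rewrite ge0_funeposM// ge0_funenegM// !esumZl// !fineM ?mulrBr//.
- rewrite ge0_fin_numE ?esum_ge0//; have := summable_funepos sa.
  by rewrite /esum.summable; under eq_esum do rewrite gee0_abs//.
- rewrite ge0_fin_numE ?esum_ge0//; have := summable_funeneg sa.
  by rewrite /esum.summable; under eq_esum do rewrite gee0_abs//.
Qed.

(** The family is dominated by [C * q], whose sum is [C]. *)
Lemma summable_expect q h C : is_pmf q -> (forall x, `|h x| <= C) ->
  summable (fun x => q x * h x).
Proof.
(* [0 <= C] can be read off the bound only at a point of [T]; over an empty type the sum is 0. *)
move=> [q0 q1] hC; have [x0|T0] := pselect (exists x : T, True); last first.
  by rewrite /esum.summable esum1// => x; case: T0; exists x.
have C0 : 0 <= C by case: x0 => x _; exact: le_trans (hC x).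
apply: (@le_lt_trans _ _ (\esum_(x in [set: T]) (C%:E * (q x)%:E))%E).
  apply: le_esum => x _ /=.
  by rewrite lee_fin normrM ger0_norm// mulrC ler_wpM2r.
by rewrite esumZl ?q1 ?mule1 ?ltry// => x; rewrite lee_fin.
Qed.

Lemma expectD q h c C : is_pmf q -> (forall x, `|h x| <= C) ->
  expect q (fun x => h x + c) = expect q h + c.
Proof.
move=> qpmf hC; have [q0 q1] := qpmf.
have sq : summable (fun x => q x * 1).
  by apply: (@summable_expect _ _ 1) => // x; rewrite normr1.
have csumq : csum (fun x => q x * 1) = 1.
  rewrite csum_ge0E ?mulr1//; first by move=> x; rewrite mulr1.
  by under eq_esum do rewrite mulr1; rewrite q1.
have sh := summable_expect qpmf hC.
(* [csumZ] scales by nonnegative constants, so a negative [c] is handled by subtracting [- c]. *)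
have [c0|/ltW c0] := leP 0 c.
  rewrite -[X in _ + X]mulr1 -csumq -csumZ// -csumD//; first exact: summable_realZ.
  by congr csum; apply/funext => x /=; ring.
rewrite -[X in _ + X]opprK -[- c]mulr1 -csumq -csumZ ?oppr_ge0// -csumB//.
  exact: summable_realZ.
by congr csum; apply/funext => x /=; ring.
Qed.

Lemma le_expect q h g C C' : is_pmf q -> (forall x, `|h x| <= C) ->
  (forall x, `|g x| <= C') -> (forall x, h x <= g x) ->
  expect q h <= expect q g.
Proof.
move=> qpmf hC gC hg; rewrite -subr_ge0 -csumB//.
- by apply: summable_expect qpmf gC.
- by apply: summable_expect qpmf hC.
by apply: csum_ge0 => x /=; rewrite -mulrBr mulr_ge0 ?subr_ge0//; case: qpmf.
Qed.

Lemma expect_cst q c : is_pmf q -> expect q (fun=> c) = c.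
Proof.
move=> qpmf; have := @expectD q (fun=> 0) c 0 qpmf.
under [X in expect _ X]eq_fun do rewrite add0r.
move=> ->; first by move=> _; rewrite normr0.
rewrite /expect csum_ge0E; first by move=> x; rewrite mulr0.
by rewrite esum1 ?add0r// => x _; rewrite mulr0.
Qed.

End csum.

(** * Log-partition functions *)

Section log_partition.
Variables (R : realType) (A : countType) (beta : R) (q : A -> R).
Hypotheses (beta_gt0 : 0 < beta) (q_pmf : is_pmf q).
Implicit Types Q : A -> R.

Local Notation Z Q := (expect q (fun a => expR (beta * Q a))).

Lemma normr_expR_le Q C a : (forall a, `|Q a| <= C) ->
  `|expR (beta * Q a)| <= expR (beta * C).
Proof.
move=> QC; rewrite ger0_norm ?expR_ge0// ler_expR ler_pM2l//.
exact: le_trans (ler_norm _) (QC a).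
Qed.

(** Every weight is at least [expR (beta * - C)], and so is their average. *)
Lemma partition_gt0 Q C : (forall a, `|Q a| <= C) -> 0 < Z Q.
Proof.
move=> QC; apply: (@lt_le_trans _ _ (expR (beta * - C))); first exact: expR_gt0.
rewrite -[leLHS](expect_cst _ q_pmf).
apply: (le_expect q_pmf) => [a|a|a]; [exact: lexx|exact: normr_expR_le QC|].
rewrite ler_expR ler_pM2l// lerNl.
by apply: le_trans (QC a); rewrite -normrN ler_norm.
Qed.

Lemma partitionZ Q C D : (forall a, `|Q a| <= C) ->
  Z (fun a => Q a + D) = expR (beta * D) * Z Q.
Proof.
move=> QC; rewrite -csumZ ?expR_ge0//.
  by apply: summable_expect => // a; exact: normr_expR_le QC.
by congr csum; apply/funext => a /=; rewrite mulrDr expRD; ring.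
Qed.

(** Shifting [Q2] by [D] multiplies its partition function by [expR (beta * D)], which the scaled
    logarithm turns back into [D]; monotonicity does the rest. This is sup-norm nonexpansiveness in
    one-sided form. *)
Lemma log_partition_le Q1 Q2 C1 C2 D : (forall a, `|Q1 a| <= C1) ->
  (forall a, `|Q2 a| <= C2) -> (forall a, Q1 a <= Q2 a + D) ->
  beta^-1 * ln (Z Q1) <= beta^-1 * ln (Z Q2) + D.
Proof.
move=> QC1 QC2 Q12.
have -> : beta^-1 * ln (Z Q2) + D = beta^-1 * (ln (expR (beta * D) * Z Q2)).
  rewrite lnM ?posrE ?expR_gt0 ?(partition_gt0 QC2)// expRK mulrDr mulKf ?gt_eqF//.
  exact: addrC.
have QD a : `|Q2 a + D| <= C2 + `|D|.
  by apply: le_trans (ler_normD _ _) _; rewrite lerD2r.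
rewrite ler_pM2l ?invr_gt0// -(partitionZ _ QC2) ler_ln ?posrE.
- exact: partition_gt0 QC1.
- exact: partition_gt0 QD.
apply: (le_expect q_pmf) => a; [exact: normr_expR_le QC1|exact: normr_expR_le QD|].
by rewrite ler_expR ler_pM2l.
Qed.

(** Comparison with the zero function, whose log-partition function vanishes, in both directions and
    with [D = C]. *)
Lemma log_partition_bounded Q C : (forall a, `|Q a| <= C) ->
  `|beta^-1 * ln (Z Q)| <= C.
Proof.
move=> QC; have Z0 : beta^-1 * ln (Z (fun=> 0)) = 0.
  by rewrite mulr0 expR0 expect_cst// ln1 mulr0.
have n0 (a : A) : `|0 : R| <= 0 by rewrite normr0.
rewrite ler_norml; apply/andP; split.
  rewrite lerNl -subr_ge0 opprK addrC -{1}Z0.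
  apply: (log_partition_le n0 QC) => a; rewrite -lerBlDr sub0r.
  by have := QC a; rewrite ler_norml => /andP[].
rewrite -[leRHS]add0r -Z0; apply: (log_partition_le QC n0) => a.
by rewrite add0r; exact: le_trans (ler_norm _) (QC a).
Qed.

End log_partition.

Lemma bounded_allP (R : realType) (T : Type) (h : T -> R) :
  [bounded h x | x in [set: T]] -> exists C : R, forall x, `|h x| <= C.
Proof. by move=> /pinfty_ex_gt0[C _ hC]; exists C => x; exact: hC. Qed.

(** * Contraction and uniqueness of bounded solutions *)

Section uniqueness.
Variables (R : realType) (S A : countType) (t : task R S A).
Hypotheses (trans_t : forall s a, is_pmf (trans t s a))
  (prior_t : forall s, is_pmf (prior t s))
  (disc_t : 0 < discount t < 1) (beta_t : 0 < invtemp t).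
Variables (B : R) (reward_t : forall s a s', `|reward t s a s'| <= B).

Lemma soft_bellman_contract Q1 Q2 C1 C2 D :
  (forall s a, `|Q1 s a| <= C1) -> (forall s a, `|Q2 s a| <= C2) ->
  soft_bellman t Q1 -> soft_bellman t Q2 ->
  (forall s a, Q1 s a <= Q2 s a + D) ->
  forall s a, Q1 s a <= Q2 s a + discount t * D.
Proof.
move: disc_t => /andP[g0 g1] QC1 QC2 Q1E Q2E Q12 s a.
(* This bound keeps the expectations below absolutely summable, as [expectD] and [le_expect]
   require. *)
have bnd Q C s' : (forall s a, `|Q s a| <= C) ->
    `|reward t s a s' + discount t / invtemp t *
      ln (expect (prior t s') (fun a' => expR (invtemp t * Q s' a')))|
    <= B + discount t * C.
  move=> QC; apply: le_trans (ler_normD _ _) _; apply: lerD => //.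
  rewrite -mulrA normrM (gtr0_norm g0) ler_pM2l//.
  exact: log_partition_bounded.
(* The constant [discount t * D] moves inside the expectation, so that the integrands can be
   compared pointwise. *)
rewrite Q1E Q2E -(@expectD _ _ _ _ _ (B + discount t * C2))//.
  by move=> s'; exact: bnd.
apply: (@le_expect _ _ _ _ _ _ (B + discount t * C2 + `|discount t * D|)) =>
  // [s'|s'|s'].
- exact: bnd QC1.
- by apply: le_trans (ler_normD _ _) _; rewrite lerD2r; exact: bnd QC2.
- rewrite -addrA lerD2l -!mulrA -mulrDr ler_pM2l//.
  exact: log_partition_le.
Qed.

Lemma soft_bellman_unique Q1 Q2 : is_optimal_Q t Q1 -> is_optimal_Q t Q2 ->
  forall s a, Q1 s a = Q2 s a.
Proof.
move=> [/bounded_allP[C1 QC1] Q1E] [/bounded_allP[C2 QC2] Q2E].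
move: disc_t => /andP[g0 g1].
have {}QC1 s a : `|Q1 s a| <= C1 by exact: (QC1 (s, a)).
have {}QC2 s a : `|Q2 s a| <= C2 by exact: (QC2 (s, a)).
(* [sup E] is the sup distance of the two solutions. Contraction in both directions gives
   [sup E <= discount t * sup E], hence [sup E <= 0]. *)
move=> s0 a0; pose E := [set `|Q1 x.1 x.2 - Q2 x.1 x.2| | x in [set: S * A]].
have E0 : E !=set0 by exists `|Q1 s0 a0 - Q2 s0 a0|, (s0, a0).
have ubE : ubound E (sup E).
  apply: ub_le_sup; exists (C1 + C2) => _ [x _ <-].
  by apply: le_trans (ler_normB _ _) _; exact: lerD.
have Q12 s a : `|Q1 s a - Q2 s a| <= sup E by apply: ubE; exists (s, a).
have supE : sup E <= discount t * sup E.
  apply: ge_sup => // _ [[s a] _ <-] /=; rewrite ler_distl lerBlDr; apply/andP; split.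
    apply: (soft_bellman_contract QC2 QC1) => // s' a'.
    by have := Q12 s' a'; rewrite ler_distl lerBlDr => /andP[].
  apply: (soft_bellman_contract QC1 QC2) => // s' a'.
  by have := Q12 s' a'; rewrite ler_distl => /andP[].
apply/eqP; rewrite -subr_eq0 -normr_le0; apply: le_trans (Q12 s0 a0) _.
by rewrite -(@pmulr_rle0 _ (1 - discount t)) ?subr_gt0// mulrBl mul1r subr_le0.
Qed.

End uniqueness.

(** * The composed task *)

Theorem theorem10 (R : realType) (S A : countType) (M : nat) (HM : (0 < M)%N)
    (p : S -> A -> S -> R) (r : 'I_M -> S -> A -> S -> R)
    (gamma beta : R) (pi0 : S -> A -> R)
    (HT : forall m, is_er_task (Task p (r m) gamma beta pi0))
    (Q : 'I_M -> S -> A -> R)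
    (HQ : forall m, is_optimal_Q (Task p (r m) gamma beta pi0) (Q m))
    (f : 'rV[R]_M -> R)
    (Hf : [bounded f x | x in [set: 'rV[R]_M]])
    (Qt : S -> A -> R)
    (HQt : is_optimal_Q (Task p (comp_reward f r) gamma beta pi0) Qt)
    (K : S -> A -> R) :
  let Vt := opt_value (Task p (comp_reward f r) gamma beta pi0) Qt in
  let pit := opt_policy (Task p (comp_reward f r) gamma beta pi0) Qt in
  let Vf := soft_value beta pi0 (comp_Q f Q) in
  let pif := soft_policy beta pi0 (comp_Q f Q) in
  let VK := soft_value beta pif K in
  let piK := soft_policy beta pif K in
  is_optimal_Q (Task p (kappa f gamma beta pi0 r Q) gamma beta pif) K ->
  forall s a,
    [/\ Qt s a = f (\row_m Q m s a) + K s a,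
        Vt s = Vf s + VK s &
        pit s a = piK s a].
Proof.
move=> Vt pit Vf pif VK piK [/bounded_allP[CK bndK] KE].
(* The tasks share all data but the reward; as [0 < M], the task of index 0 supplies the facts on
   [p], [gamma], [beta] and [pi0]. *)
have [/= p_pmf _ g01 beta0 pi0_pmf _] := HT (Ordinal HM).
have {bndK}KC s a : `|K s a| <= CK by exact: (bndK (s, a)).
have [Cf fC] := bounded_allP Hf.
pose F := comp_Q f Q.
pose G s a := F s a + K s a.
have FC s a : `|F s a| <= Cf by exact: fC.
have GC s a : `|G s a| <= Cf + CK.
  by apply: le_trans (ler_normD _ _) _; exact: lerD.
pose Z (H : S -> A -> R) s := expect (pi0 s) (fun a => expR (beta * H s a)).
have ZF0 s : 0 < Z F s by exact: (partition_gt0 beta0 (pi0_pmf s) (FC s)).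
have ZG0 s : 0 < Z G s by exact: (partition_gt0 beta0 (pi0_pmf s) (GC s)).
have expVf s : expR (beta * Vf s) = Z F s.
  by rewrite /Vf /soft_value mulVKf ?gt_eqF//; apply: lnK; exact: ZF0.
(* The policy [pif] is [pi0] times [expR (beta * F)] over [Z F], and its exponential merges with
   that of [K] into [expR (beta * G)]. *)
have ZK s : expect (pif s) (fun a => expR (beta * K s a)) = (Z F s)^-1 * Z G s.
  rewrite /Z /expect -csumZ ?invr_ge0 ?(ltW (ZF0 s))//.
    by apply: summable_expect => // a; exact: (normr_expR_le beta0 _ (GC s)).
  congr csum; apply/funext => a /=; rewrite /pif /soft_policy expVf /G.
  by rewrite mulrDr expRD; ring.
have VKE s : VK s = soft_value beta pi0 G s - Vf s.
  rewrite /VK /soft_value ZK lnM ?posrE ?invr_gt0// lnV ?posrE//.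
  by rewrite mulrDr mulrN addrC.
have expVK s : expR (beta * VK s) = (Z F s)^-1 * Z G s.
  by rewrite /VK /soft_value mulVKf ?gt_eqF// ZK lnK// posrE mulr_gt0 ?invr_gt0.
have GE : is_optimal_Q (Task p (comp_reward f r) gamma beta pi0) G.
  split.
    exists (Cf + CK); split=> [|C CfK [s a] _]; first exact: num_real.
    exact: le_trans (GC s a) (ltW CfK).
  move=> s a; rewrite {1}/G KE /=.
  (* By [VKE], the [- Vf s'] from the log-partition term cancels [gamma * Vf s'] in [kappa] after
     scaling by [gamma]. The remaining [- F s a] does not depend on [s'], leaves the expectation and
     cancels the [F s a] of [G]. *)
  under [X in expect _ X]eq_fun => s'.
    rewrite (_ : _ + _ = comp_reward f r s a s' +
      gamma / beta * ln (Z G s') + - F s a).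
      have := VKE s'; rewrite /VK {1 2}/soft_value -/(Z G s') => VKs'.
      by rewrite -[gamma / beta * _]mulrA VKs' /kappa -/Vf -/F; ring.
    over.
  rewrite (@expectD _ _ _ _ _ (Cf + gamma * (Cf + CK))) //; last by rewrite addrC subrK.
  move=> s'; apply: le_trans (ler_normD _ _) _; apply: lerD; first exact: fC.
  move/andP: g01 => [g0 _]; rewrite -mulrA normrM (gtr0_norm g0) ler_pM2l//.
  exact: log_partition_bounded.
have QtE s a : Qt s a = G s a.
  (* The composed reward is bounded because [f] is. *)
  have rC s0 a0 s' : `|comp_reward f r s0 a0 s'| <= Cf by exact: fC.
  exact: (@soft_bellman_unique _ _ _
    (Task p (comp_reward f r) gamma beta pi0) p_pmf pi0_pmf g01 beta0 _ rC).
have {}QtE : Qt = G by apply/funext => s; apply/funext => a; exact: QtE.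
move=> s a; split; first by rewrite QtE.
  by rewrite VKE addrC subrK /Vt /opt_value QtE.
(* In [piK] the factor [Z F] of [pif] cancels against the one in [expVK], leaving the Gibbs weight
   of [G] over [Z G]. *)
rewrite /piK /soft_policy -/VK expVK /pif /soft_policy -/Vf expVf.
rewrite /pit /opt_policy QtE /= -/(expect _ _) -/(Z G s) /G mulrDr expRD.
by field; rewrite !gt_eqF.
Qed.
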